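(* Let $r\geq3$. Then $$\sum_{n\geq1}\det(1;T_{0}^{(r)},T_{2}^{(r)},\ldots,T_{2n-2}^{(r)})x^n=\begin{cases}\dfrac{(-x)^{\frac{r+1}{2}}(-1-x)}{1+3x+x^2-(-x)^{\frac{r+1}{2}}-(-x)^{\frac{r+3}{2}}+x^r}, & r\text{ odd};\\[8pt] \dfrac{-(-x)^{\frac{r}{2}+1}}{1+3x+x^2-2(-x)^{\frac{r}{2}}+3(-x)^{\frac{r}{2}+1}+x^r}, & r\text{ even},\end{cases}$$ $$\sum_{n\geq1}\det(-1;T_{0}^{(r)},T_{2}^{(r)},\ldots,T_{2n-2}^{(r)})x^n=\begin{cases}\dfrac{x^{\frac{r+1}{2}}(1-x)}{1-3x+x^2-3x^{\frac{r+1}{2}}+x^{\frac{r+3}{2}}-x^r}, & r\text{ odd};\\[8pt] \dfrac{x^{\frac{r}{2}+1}}{1-3x+x^2-2x^{\frac{r}{2}}+x^{\frac{r}{2}+1}+x^r}, & r\text{ even},\end{cases}$$ and $$\sum_{n\geq1}\det(1;T_{r+2}^{(r)},T_{r+3}^{(r)},\ldots,T_{n+r+1}^{(r)})x^n=\frac{3x-2x^2-(-x)^{r-2}-(-x)^{r-1}-2(-x)^r}{1-2x+x^2+(-x)^{r-2}+(-x)^{r-1}+(-x)^r},$$ as formal power series in $x$.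
   Context: For $r\ge3$, the generalized $r$-tribonacci numbers are defined by $T_0^{(r)}=\cdots=T_{r-2}^{(r)}=0$, $T_{r-1}^{(r)}=1$, and $T_n^{(r)}=T_{n-1}^{(r)}+T_{n-2}^{(r)}+T_{n-r}^{(r)}$ for $n\geq r$. For numbers $a_0,\ldots,a_n$, $\det(a_0;a_1,\ldots,a_n)$ denotes the determinant of the $n\times n$ Toeplitz--Hessenberg matrix whose $(i,j)$ entry is $a_{i-j+1}$ if $i-j+1\ge0$ and $0$ otherwise; in $T_0^{(r)},T_2^{(r)},\ldots,T_{2n-2}^{(r)}$ the $k$-th entry is $T_{2k-2}^{(r)}$. *)

(* Defs.v *)
From HB Require Import structures.
From mathcomp Require Import all_boot all_order all_algebra.
From mathcomp Require Import boolp.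

Set Implicit Arguments.
Unset Strict Implicit.
Unset Printing Implicit Defensive.

Import GRing.Theory.
Local Open Scope ring_scope.

(* A record rather than an alias of [nat -> R], so that the pointwise ring
   structure on functions can never be inferred in place of the one below. *)
Record fps (R : comUnitRingType) := Fps { fpscoef : nat -> R }.

Section FpsRing.
Variable R : comUnitRingType.
Implicit Types f g h : fps R.

Lemma fpsP f g : fpscoef f =1 fpscoef g -> f = g.
Proof. by case: f g => [f] [g] /= /funext ->. Qed.

HB.instance Definition _ := gen_eqMixin (fps R).
HB.instance Definition _ := gen_choiceMixin (fps R).

Definition fps0 : fps R := Fps (fun=> 0).
Definition fps1 : fps R := Fps (fun n => (n == 0%N)%:R).
Definition fpsX : fps R := Fps (fun n => (n == 1%N)%:R).
Definition fpsopp f : fps R := Fps (fun n => - fpscoef f n).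
Definition fpsadd f g : fps R := Fps (fun n => fpscoef f n + fpscoef g n).
Definition fpsmul f g : fps R :=
  Fps (fun n => \sum_(i < n.+1) fpscoef f i * fpscoef g (n - i)%N).

Fact fpsaddA : associative fpsadd.
Proof. by move=> f g h; apply: fpsP => n /=; rewrite addrA. Qed.
Fact fpsaddC : commutative fpsadd.
Proof. by move=> f g; apply: fpsP => n /=; rewrite addrC. Qed.
Fact fpsadd0 : left_id fps0 fpsadd.
Proof. by move=> f; apply: fpsP => n /=; rewrite add0r. Qed.
Fact fpsaddN : left_inverse fps0 fpsopp fpsadd.
Proof. by move=> f; apply: fpsP => n /=; rewrite addNr. Qed.

HB.instance Definition _ :=
  GRing.isZmodule.Build (fps R) fpsaddA fpsaddC fpsadd0 fpsaddN.

Let trunc n f : {poly R} := \poly_(i < n.+1) fpscoef f i.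

Let trunc_coef n f i : (i <= n)%N -> (trunc n f)`_i = fpscoef f i.
Proof. by move=> le_in; rewrite coef_poly ltnS le_in. Qed.

Let fpsmulE n f g i : (i <= n)%N ->
  fpscoef (fpsmul f g) i = (trunc n f * trunc n g)`_i.
Proof.
move=> le_in; rewrite coefM /=; apply: eq_bigr => j _.
have le_ji : (j <= i)%N by rewrite -ltnS.
by rewrite !trunc_coef // (leq_trans _ le_in) // leq_subr.
Qed.

Fact fpsmulA : associative fpsmul.
Proof.
move=> f g h; apply: fpsP => n /=.
transitivity ((trunc n f * (trunc n g * trunc n h))`_n).
  rewrite coefM; apply: eq_bigr => j _.
  have le_jn : (j <= n)%N by rewrite -ltnS.
  by rewrite trunc_coef // -fpsmulE // leq_subr.
rewrite mulrA coefM; apply: eq_bigr => j _.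
have le_jn : (j <= n)%N by rewrite -ltnS.
by rewrite -fpsmulE // trunc_coef // leq_subr.
Qed.

Fact fpsmulC : commutative fpsmul.
Proof. by move=> f g; apply: fpsP => n; rewrite !(@fpsmulE n) // mulrC. Qed.

Fact fpsmul1 : left_id fps1 fpsmul.
Proof.
move=> f; apply: fpsP => n /=.
by rewrite big_ord_recl /= mul1r subn0 big1 ?addr0 // => i _; rewrite mul0r.
Qed.

Fact fpsmulD : left_distributive fpsmul fpsadd.
Proof.
move=> f g h; apply: fpsP => n /=.
by rewrite -big_split; apply: eq_bigr => i _; rewrite mulrDl.
Qed.

Fact fps1_neq0 : fps1 != 0.
Proof.
by apply/eqP => /(congr1 (fun f => fpscoef f 0%N)) /= /eqP; rewrite oner_eq0.
Qed.

HB.instance Definition _ := GRing.Zmodule_isComNzRing.Build (fps R)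
  fpsmulA fpsmulC fpsmul1 fpsmulD fps1_neq0.

Definition fpsunit : pred (fps R) :=
  [pred f : fps R | fpscoef f 0%N \is a GRing.unit].

(* The list of the coefficients g_0, ..., g_(n-1) of the inverse g of f,
   obtained by solving f_0 * g_m + \sum_(i < m) f_(m-i) * g_i = (m == 0). *)
Fixpoint fpsinv_seq f n : seq R :=
  if n is m.+1 then
    let s := fpsinv_seq f m in
    rcons s ((fpscoef f 0%N)^-1 *
             ((m == 0%N)%:R - \sum_(i < m) fpscoef f (m - i)%N * s`_i))
  else [::].

Definition fpsinv f : fps R :=
  if fpsunit f then Fps (fun n => (fpsinv_seq f n.+1)`_n) else f.

Let size_fpsinv_seq f n : size (fpsinv_seq f n) = n.
Proof. by elim: n => //= n IHn; rewrite size_rcons IHn. Qed.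

Let nth_fpsinv_seq f n i : (i < n)%N ->
  (fpsinv_seq f n)`_i = (fpsinv_seq f i.+1)`_i.
Proof.
elim: n => // n IHn; rewrite ltnS leq_eqVlt => /orP[/eqP-> // | lt_in].
by rewrite -IHn //= nth_rcons size_fpsinv_seq lt_in.
Qed.

Fact fpsmulV : {in fpsunit, left_inverse 1 fpsinv *%R}.
Proof.
move=> f Uf; rewrite mulrC /fpsinv [fpsunit f]Uf; apply: fpsP => n.
rewrite /GRing.mul [LHS]/= big_ord_recl subn0 /= nth_rcons size_fpsinv_seq.
rewrite ltnn eqxx mulVKr // -[RHS](subrK (\sum_(i < n)
  fpscoef f (n - i)%N * (fpsinv_seq f n)`_i)); congr (_ + _).
rewrite (reindex_inj rev_ord_inj) /=; apply: eq_bigr => i _.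
have lt_in := ltn_ord i.
rewrite /bump add1n subnSK // subKn; last exact: ltnW.
by rewrite (nth_fpsinv_seq f lt_in).
Qed.

Fact fpsunitP f g : g * f = 1 -> fpsunit f.
Proof.
move=> /(congr1 (fun h => fpscoef h 0%N)); rewrite /GRing.mul /= big_ord1 => gf1.
by apply/unitrPr; exists (fpscoef g 0%N); rewrite mulrC.
Qed.

Fact fpsinv_out : {in [predC fpsunit], fpsinv =1 id}.
Proof. by move=> f /negPf Uf; rewrite /fpsinv [fpsunit f]Uf. Qed.

HB.instance Definition _ := GRing.ComNzRing_hasMulInverse.Build (fps R)
  fpsmulV fpsunitP fpsinv_out.

(* The formal sum \sum_(n >= 1) c n * x ^ n. *)
Definition fps_sum1 (c : nat -> R) : fps R :=
  Fps (fun n => if n is 0%N then 0 else c n).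

End FpsRing.

(* det(a0; a 1, ..., a n).  Indices i, j start from 0 here, which does not
   affect i - j + 1; the values a 0 and a k for k > n are never used. *)
Definition toeplitz_hessenberg (R : comNzRingType) (n : nat) (a0 : R)
    (a : nat -> R) : 'M[R]_n :=
  \matrix_(i < n, j < n)
    if (j < i.+1)%N then a (i.+1 - j)%N
    else if (j == i.+1 :> nat) then a0 else 0.

Definition det_TH (R : comNzRingType) (n : nat) (a0 : R) (a : nat -> R) : R :=
  \det (toeplitz_hessenberg n a0 a).

(* In the recursive branch n2 = n - 2, so that n2 - (r - 2) = n - r. *)
Fixpoint trib (r n : nat) : nat :=
  if (n < r.-1)%N then 0%N
  else if n == r.-1 then 1%N
  else if n is n1.+1 then
    if n1 is n2.+1 then (trib r n1 + trib r n2 + trib r (n2 - (r - 2)))%N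
    else 0%N
  else 0%N.

Lemma trib_lt r n : (n < r.-1)%N -> trib r n = 0%N.
Proof. by case: n => [|n] /= ->. Qed.

Lemma trib_pred r : trib r r.-1 = 1%N.
Proof. by case: r => [|[|r]] //=; rewrite ltnn eqxx. Qed.

Lemma trib_rec r n : (3 <= r)%N -> (r <= n)%N ->
  trib r n = (trib r (n - 1) + trib r (n - 2) + trib r (n - r))%N.
Proof.
case: r => [|[|r]] //; case: n => [|[|n]] // _ le_rn.
rewrite !subSS !subn0 /= [(n.+2 < _)%N]ltnNge (leqW _) //= !subSS subn0.
by rewrite gtn_eqF.
Qed.

(* Main.v *)
From HB Require Import structures.
Require Import Defs.
From mathcomp Require Import all_boot all_order all_algebra.
From mathcomp Require Import ring zify.

Set Implicit Arguments.
Unset Strict Implicit.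
Unset Printing Implicit Defensive.

Import GRing.Theory.
Local Open Scope ring_scope.

(**
  Expanding a Toeplitz-Hessenberg determinant along its first row shows that
  the series S = sum_(n >= 1) det(a0; a_1, ..., a_n) x^n satisfies
  S = G + G S with G = sum_(n >= 1) (- a0)^(n-1) a_n x^n.  For a0 = -1 this is
  the generating function g of a, and for a0 = 1 it is - g(-x).  As g is a
  quotient p / d of polynomials, S is p / (d - p), respectively
  - p(-x) / (d(-x) + p(-x)).
  The generating function of the even-indexed T_n is found by splitting the
  recurrence of T into its even and odd parts, which gives two linear
  equations.
*)

(** * Recurrence for Toeplitz-Hessenberg determinants *)

Section Determinant.
Variables (R : comNzRingType) (a0 : R) (a : nat -> R).

Let hessenberg_col (n : nat) (b : nat -> R) : 'M[R]_n :=
  \matrix_(i < n, j < n) if j == 0%N :> nat then b i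
                         else toeplitz_hessenberg n a0 a i j.

(* Deleting the first row and the second column of a Toeplitz-Hessenberg matrix
   with arbitrary first column b leaves a matrix of the same shape. *)
Let det_hessenberg_col n b :
  \det (hessenberg_col n.+1 b) =
  \sum_(i < n.+1) (- a0) ^+ i * b i * det_TH (n - i) a0 a.
Proof.
elim: n b => [|n IHn] b.
  by rewrite det_mx11 !mxE big_ord1 /= mul1r /det_TH det_mx00 mulr1.
rewrite (expand_det_row _ ord0) big_ord_recl big_ord_recl.
rewrite big1 => [|i _]; last first.
  by rewrite !mxE /= /bump /= mul0r.
rewrite [RHS]big_ord_recl addr0 !mxE /= /cofactor /= expr0.
rewrite !mul1r expr1 mulN1r mulrN -mulNr.
congr (_ * \det _ + _).
  by apply/matrixP => i j; rewrite !mxE /= /bump /= !add1n subSS.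
have -> : row' ord0 (col' (lift ord0 ord0) (hessenberg_col n.+2 b))
        = hessenberg_col n.+1 (fun k => b k.+1).
  apply/matrixP => i j; rewrite !mxE /= /bump /=.
  by case: (val j) => [|k] //=; rewrite !add1n subSS.
rewrite IHn mulr_sumr; apply: eq_bigr => i _.
by rewrite /bump /= add1n exprS subSS !mulrA.
Qed.

Lemma det_TH_rec n :
  det_TH n.+1 a0 a = \sum_(i < n.+1) (- a0) ^+ i * a i.+1 * det_TH (n - i) a0 a.
Proof.
rewrite -(det_hessenberg_col n (fun k => a k.+1)) /det_TH; congr (\det _).
by apply/matrixP => i [[|j] lt_jn]; rewrite !mxE //= subn0.
Qed.

End Determinant.

(** * Power series and the determinant generating function *)

Section Fps.
Variable R : comUnitRingType.
Implicit Types f g p d : fps R.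

Lemma coef_fpsD f g n : fpscoef (f + g) n = fpscoef f n + fpscoef g n.
Proof. by []. Qed.

Lemma coef_fpsM f g n :
  fpscoef (f * g) n = \sum_(i < n.+1) fpscoef f i * fpscoef g (n - i)%N.
Proof. by []. Qed.

Lemma coef_fpsXnM k f n :
  fpscoef (fpsX R ^+ k * f) n = if (n < k)%N then 0 else fpscoef f (n - k)%N.
Proof.
elim: k n => [|k IHk] n; first by rewrite mul1r subn0.
rewrite exprS -mulrA coef_fpsM; case: n => [|n].
  by rewrite big_ord1 /= mul0r.
rewrite big_ord_recl big_ord_recl.
rewrite big1 => [|i _]; last by rewrite [X in X * _]/= mul0r.
rewrite [X in X * _ + _]/= mul0r add0r mul1r addr0 IHk.
by rewrite /bump /= !subSS subn0 ltnS.
Qed.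

Lemma coef_fpsXM f n :
  fpscoef (fpsX R * f) n = if n is n'.+1 then fpscoef f n' else 0.
Proof.
by rewrite -[fpsX R]expr1 coef_fpsXnM; case: n => // n; rewrite subn1.
Qed.

Lemma coef_fpsXn k n : fpscoef (fpsX R ^+ k) n = (n == k)%:R.
Proof.
rewrite -[fpsX R ^+ k]mulr1 coef_fpsXnM /= subn_eq0.
by case: ltngtP.
Qed.

(** The constant coefficient is 1. Exhibiting the cofactor [f] of the variable turns invertibility
    of an explicit denominator into a [ring] identity. *)
Lemma fps_unit1 f den : den = 1 + fpsX R * f -> den \is a GRing.unit.
Proof.
by move->; rewrite unfold_in /= /fpsunit /= big_ord1 mul0r addr0 unitr1.
Qed.

(** The substitution of c x for x, used with c = -1; being a ring morphism, it passes through
    polynomial expressions in x. *)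
Definition fps_scale (c : R) f : fps R := Fps (fun n => c ^+ n * fpscoef f n).

Fact fps_scale_additive c : zmod_morphism (fps_scale c).
Proof. by move=> f g; apply: fpsP => n /=; rewrite mulrBr. Qed.

Fact fps_scale_multiplicative c : monoid_morphism (fps_scale c).
Proof.
split=> [|f g]; apply: fpsP => n.
  by case: n => [|n]; rewrite /= ?mulr1 ?mulr0.
rewrite [LHS]/= !coef_fpsM mulr_sumr; apply: eq_bigr => i _ /=.
by rewrite mulrACA -exprD subnKC // -ltnS.
Qed.

HB.instance Definition _ c := GRing.isZmodMorphism.Build (fps R) (fps R)
  (fps_scale c) (fps_scale_additive c).
HB.instance Definition _ c := GRing.isMonoidMorphism.Build (fps R) (fps R)
  (fps_scale c) (fps_scale_multiplicative c).

Lemma fps_scaleN1X : fps_scale (- 1) (fpsX R) = - fpsX R.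
Proof. by apply: fpsP => -[|[|n]] /=; rewrite ?mulr0 ?oppr0 ?mulr1. Qed.

Lemma fps_sum1_det_TH (a0 : R) (a : nat -> R) :
  let S := fps_sum1 (fun n => det_TH n a0 a) in
  let G := fps_sum1 (fun n => (- a0) ^+ n.-1 * a n) in
  S = G + G * S.
Proof.
move=> S G; apply: fpsP => -[|n].
  by rewrite /= big_ord1 mul0r addr0.
have -> : fpscoef (G + G * S) n.+1 = (- a0) ^+ n * a n.+1 +
    \sum_(i < n.+2) fpscoef G i * fpscoef S (n.+1 - i) by [].
rewrite [LHS]/= det_TH_rec [in RHS]big_ord_recl mul0r add0r.
(* The last term on the left contains the empty determinant, equal to 1, and gives the isolated
   coefficient of [G]. The last term of the product vanishes because [S] has constant coefficient
   0. *)
rewrite big_ord_recr [in RHS]big_ord_recr /= /bump /= !add1n.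
rewrite !subnn mulr0 addr0 addrC.
rewrite [det_TH 0 _ _]det_mx00 mulr1; congr (_ + _).
apply: eq_bigr => i _; rewrite add0n add1n subSS.
by case: (n - i)%N (subn_gt0 i n) => [|m _] //; rewrite ltn_ord.
Qed.

(** With g the series of [a], S = g + g S and p = g d give S (d - p) = S d - S g d = g d = p. *)
Lemma fps_sum1_det_THN1 (a : nat -> R) p d den :
    fps_sum1 a * d = p -> d - p = den -> den \is a GRing.unit ->
  fps_sum1 (fun n => det_TH n (- 1) a) = p / den.
Proof.
move=> gd <- Udp; apply: (canRL (mulrK Udp)).
have := fps_sum1_det_TH (- 1) a; set S := fps_sum1 _; set G := fps_sum1 _ => SE.
have GE : G = fps_sum1 a.
  by apply: fpsP => -[|n] //=; rewrite opprK expr1n mul1r.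
by rewrite -gd -GE mulrBr {1}SE; ring.
Qed.

Lemma fps_sum1_det_TH1 (a : nat -> R) p d num den :
    fps_sum1 a * d = p -> - fps_scale (- 1) p = num ->
    fps_scale (- 1) d + fps_scale (- 1) p = den -> den \is a GRing.unit ->
  fps_sum1 (fun n => det_TH n 1 a) = num / den.
Proof.
move=> gd <- <- Udp; apply: (canRL (mulrK Udp)).
have := fps_sum1_det_TH 1 a; set S := fps_sum1 _; set G := fps_sum1 _ => SE.
(* Here (-1)^(n-1) a_n = - (-1)^n a_n. *)
have GE : G = - fps_scale (- 1) (fps_sum1 a).
  apply: fpsP => -[|n]; first by rewrite /= mulr0 oppr0.
  by rewrite /= exprS mulN1r mulNr opprK.
have -> : fps_scale (- 1) p = - (G * fps_scale (- 1) d).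
  by rewrite GE mulNr opprK -rmorphM gd.
by rewrite mulrDr {1}SE; ring.
Qed.

End Fps.

(** * Generating functions of the tribonacci subsequences *)

Section Tribonacci.
Variable r : nat.
Hypothesis hr : (3 <= r)%N.

Let x : fps int := fpsX int.
Let T (n : nat) : int := (trib r n)%:Z.

(** The indicator supplies T_(r-1) = 1, so the recurrence also holds below r. The guards replace
    truncated subtraction by 0, exactly as in the coefficients of a product with a power of x, so
    that equations between series can be read off termwise. *)
Lemma trib_recE n :
  T n = (n == r.-1)%:R + (if (n < 1)%N then 0 else T (n - 1))
        + (if (n < 2)%N then 0 else T (n - 2))
        + (if (n < r)%N then 0 else T (n - r)).
Proof.
rewrite /T; case: (ltngtP n r.-1) => [lt_nr|gt_nr|->].
- rewrite trib_lt // !(@trib_lt r (n - _)); try lia.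
  have -> : (n < r)%N by lia.
  by do 2!case: ifP.
- rewrite trib_rec //; last lia.
  by rewrite !ifF ?add0r ?PoszD; lia.
- rewrite trib_pred !(@trib_lt r (_ - _)); try lia.
  have -> : (r.-1 < r)%N by lia.
  by do 2!case: ifP.
Qed.

Lemma trib_even_gf :
  fps_sum1 (fun k => T (2 * k - 2))
    * (if odd r then (1 - x) ^+ 2 - x * (1 + x ^+ r./2) ^+ 2
       else (1 - x - x ^+ r./2) ^+ 2 - x)
  = if odd r then x ^+ (r./2 + 1) * (1 - x) else x ^+ (r./2 + 1).
Proof.
have [E En] : {E : fps int | forall n, fpscoef E n = T (2 * n)}.
  by exists (Fps (fun n => T (2 * n))).
have [O On] : {O : fps int | forall n, fpscoef O n = T (2 * n + 1)}.
  by exists (Fps (fun n => T (2 * n + 1))).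
have -> : fps_sum1 (fun k => T (2 * k - 2)) = x * E.
  by apply: fpsP => -[|n]; rewrite coef_fpsXM //= En; congr T; lia.
have r2 := odd_double_half r; case: ifP r2 => _ r2.
  (* With r = 2h + 1, the index r - 1 = 2h is even, so the initial 1 enters the even part; shifting
     by r exchanges the two parities. *)
  have EE : E = x ^+ r./2 + x ^+ 1 * O + x ^+ 1 * E + x ^+ (r./2 + 1) * O.
    apply: fpsP => n; rewrite 3!coef_fpsD coef_fpsXn 3!coef_fpsXnM.
    rewrite ?En ?On [LHS]trib_recE /=.
    congr (_ + _ + _ + _); first (by congr (_%:R); lia);
      do ?case: ifP => //; try lia; move=> *; congr T; lia.
  have OE : O = E + x ^+ 1 * O + x ^+ r./2 * E.
    apply: fpsP => n; rewrite 2!coef_fpsD 2!coef_fpsXnM.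
    rewrite ?En ?On [LHS]trib_recE /=.
    have -> : (2 * n + 1 == r.-1)%N = false by lia.
    rewrite add0r; congr (_ + _ + _);
      do ?case: ifP => //; try lia; move=> *; congr T; lia.
  move: EE OE; rewrite exprD !expr1; move: (x ^+ _) => y EE OE.
  have E1 : E * (1 - x) = y + x * (1 + y) * O by rewrite mulrBr {1}EE; ring.
  have O1 : O * (1 - x) = (1 + y) * E by rewrite mulrBr {1}OE; ring.
  (* Elimination of [O]: after [E1] and [O1] the multiples of [O] cancel and x y (1 - x) remains. *)
  transitivity (x * (E * (1 - x) * (1 - x) - x * (1 + y) * ((1 + y) * E))).
    by ring.
  by rewrite E1 -O1; ring.
have r2_gt0 : (0 < r./2)%N by lia.
have EE : E = x ^+ 1 * O + x ^+ 1 * E + x ^+ r./2 * E.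
  apply: fpsP => n; rewrite 2!coef_fpsD 3!coef_fpsXnM.
  rewrite ?En ?On [LHS]trib_recE /=.
  have -> : (2 * n == r.-1)%N = false by lia.
  rewrite add0r; congr (_ + _ + _);
    do ?case: ifP => //; try lia; move=> *; congr T; lia.
(* With r = 2h, the initial 1 sits at the odd index r - 1 = 2(h - 1) + 1, and shifting by r
   preserves parity. *)
have OE : O = x ^+ (r./2).-1 + E + x ^+ 1 * O + x ^+ r./2 * O.
  apply: fpsP => n; rewrite 3!coef_fpsD coef_fpsXn 2!coef_fpsXnM.
  rewrite ?En ?On [LHS]trib_recE /=.
  congr (_ + _ + _ + _); first (by congr (_%:R); lia);
    do ?case: ifP => //; try lia; move=> *; congr T; lia.
move: EE OE; rewrite -(prednK r2_gt0) /= exprD !expr1 exprS.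
move: (x ^+ _) => y EE OE.
have E1 : E * (1 - x - x * y) = x * O by rewrite !mulrBr {1}EE; ring.
have O1 : O * (1 - x - x * y) = y + E by rewrite !mulrBr {1}OE; ring.
transitivity (x * (E * (1 - x - x * y) * (1 - x - x * y) - x * E)); first ring.
by rewrite E1 -[x * O * _]mulrA O1; ring.
Qed.

Lemma trib_shift_gf :
  fps_sum1 (fun k => T (k + r + 1)) * (1 - x - x ^+ 2 - x ^+ r)
  = 3 * x + 2 * x ^+ 2 + x ^+ (r - 2) * (1 + x + 2 * x ^+ 2).
Proof.
set g := fps_sum1 _.
have Trp : T r.-1 = 1 by rewrite /T trib_pred.
have Tlt n : (n < r.-1)%N -> T n = 0 by move=> lt_nr; rewrite /T trib_lt.
have eq0 (m n : nat) : (m != n)%N -> (m == n)%:R = 0 :> int by move/negPf->.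
have Tr : T r = 1.
  by rewrite trib_recE eq0 ?subn1 ?Trp ?(Tlt (r - _)%N) ?if_same ?ifF //; lia.
have Tr1 : T r.+1 = 2.
  rewrite trib_recE eq0 ?subn1 ?subn2 /= ?Tr ?Trp; last by lia.
  by rewrite ?(Tlt (r.+1 - _)%N) ?if_same ?ifF //; lia.
(* This is the term T_(n+r+1-r) of the recurrence. The coefficients of [g] start at T_(r+2), so the
   values T_(r-1) = 1, T_r = 1 and T_(r+1) = 2 become separate corrections at n = r - 2, r - 1 and
   r. *)
have Tn1 n : (0 < n)%N -> T (n + 1) =
    (n == r - 2)%N%:R + (n == r - 1)%N%:R + (n == r)%:R + (n == r)%:R
    + if (n < r)%N then 0 else fpscoef g (n - r).
  move=> n_gt0; have [lt_nr|lt_rn|->] := ltngtP n r.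
  - rewrite mulr0n !addr0.
    have [->|n_r1] := eqVneq n (r - 1)%N.
      by rewrite eq0 ?subnK ?Tr //; lia.
    have [->|n_r2] := eqVneq n (r - 2)%N.
      have -> : (r - 2 + 1 = r.-1)%N by lia.
      by rewrite Trp.
    by rewrite Tlt //; lia.
  - rewrite !eq0; try lia.
    rewrite mulr0n !add0r /=.
    case: (n - r)%N (subn_gt0 r n) (subnK (ltnW lt_rn)) => [|m] /=; first lia.
    by move=> _ <-; congr T; lia.
  - rewrite !eq0; try lia.
    by rewrite subnn /= addn1 Tr1.
(* Likewise, 3 = T_(r+1) + T_r at n = 1 and 2 = T_(r+1) at n = 2 account for the terms that the
   shifts of [g] by 1 and 2 miss. Repeated monomials stand for the multiples so that [coef_fpsXn]
   applies. *)
have gE : g = x ^+ 1 + x ^+ 1 + x ^+ 1 + x ^+ 2 + x ^+ 2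
    + (x ^+ (r - 2) + x ^+ (r - 1) + x ^+ r + x ^+ r + x ^+ r * g)
    + x ^+ 1 * g + x ^+ 2 * g.
  apply: fpsP => n; rewrite 11!coef_fpsD !coef_fpsXn 3!coef_fpsXnM.
  case: n => [|n]; first by rewrite !eq0 /= ?ifT //; lia.
  have -> : fpscoef g n.+1 = T (n + r + 1) + T (n + r) + T (n.+1 + 1).
    rewrite /= trib_recE eq0 ?add0r ?ifF; try lia.
    by congr (T _ + T _ + T _); lia.
  rewrite -Tn1 //; case: n => [|[|n]] /=.
  - by rewrite add0n addn1 Tr1 Tr; ring.
  - by rewrite add1n Tr1; ring.
  - by rewrite subn1 subn2 /= -[(n.+2 + r)%N]addn1 addSn; ring.
have xr : x ^+ r = x ^+ (r - 2) * x ^+ 2 by rewrite -exprD subnK //; lia.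
have xr1 : x ^+ (r - 1) = x ^+ (r - 2) * x.
  by rewrite -exprSr; congr (_ ^+ _); lia.
move: gE; rewrite xr xr1; move: (x ^+ (r - 2)) => y gE.
by rewrite !mulrBr {1}gE; ring.
Qed.

End Tribonacci.

(** * The three determinant series in closed form *)

Theorem theorem10 (r : nat) (hr : (3 <= r)%N) :
  let x : fps int := fpsX int in
  [/\ fps_sum1 (fun n =>
        det_TH n (1 : int) (fun k => (trib r (2 * k - 2))%:Z)) =
      (if odd r then
         (- x) ^+ ((r + 1) %/ 2) * (- 1 - x) /
         (1 + 3 * x + x ^+ 2 - (- x) ^+ ((r + 1) %/ 2)
            - (- x) ^+ ((r + 3) %/ 2) + x ^+ r)
       else
         - (- x) ^+ (r %/ 2 + 1) /
         (1 + 3 * x + x ^+ 2 - 2 * (- x) ^+ (r %/ 2)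
            + 3 * (- x) ^+ (r %/ 2 + 1) + x ^+ r)),
      fps_sum1 (fun n =>
        det_TH n (- 1 : int) (fun k => (trib r (2 * k - 2))%:Z)) =
      (if odd r then
         x ^+ ((r + 1) %/ 2) * (1 - x) /
         (1 - 3 * x + x ^+ 2 - 3 * x ^+ ((r + 1) %/ 2)
            + x ^+ ((r + 3) %/ 2) - x ^+ r)
       else
         x ^+ (r %/ 2 + 1) /
         (1 - 3 * x + x ^+ 2 - 2 * x ^+ (r %/ 2)
            + x ^+ (r %/ 2 + 1) + x ^+ r))
    & fps_sum1 (fun n =>
        det_TH n (1 : int) (fun k => (trib r (k + r + 1))%:Z)) =
      (3 * x - 2 * x ^+ 2 - (- x) ^+ (r - 2) - (- x) ^+ (r - 1)
         - 2 * (- x) ^+ r) /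
      (1 - 2 * x + x ^+ 2 + (- x) ^+ (r - 2) + (- x) ^+ (r - 1)
         + (- x) ^+ r)].
Proof.
move=> x.
pose scaleE := (rmorphXn, rmorphM, rmorphB, rmorphD, rmorph1, rmorph_nat).
have gd := trib_even_gf hr.
(* For a0 = 1 every high power is rewritten as a power of - x; its half power then becomes an atom
   y, and polynomial identities in x and y remain. *)
have xrN : x ^+ r = (-1) ^+ odd r * (- x) ^+ r.
  by rewrite signr_odd -exprMn mulN1r opprK.
have r_half := odd_double_half r.
split.
- move: gd xrN r_half; case: (odd r) => gd -> r_half.
    have [-> ->] : [/\ (r + 1) %/ 2 = r./2 + 1 & (r + 3) %/ 2 = r./2 + 2]%N.
      by split; lia.
    have -> : (- x) ^+ r = - x * (- x) ^+ r./2 ^+ 2.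
      by rewrite -exprM -exprS; congr (_ ^+ _); lia.
    rewrite !exprD !expr1; apply: (fps_sum1_det_TH1 gd).
    + rewrite exprD !scaleE /= !fps_scaleN1X -/x.
      by move: ((- x) ^+ r./2) => y; ring.
    + rewrite exprD !scaleE /= !fps_scaleN1X -/x.
      by move: ((- x) ^+ r./2) => y; ring.
    + move: ((- x) ^+ r./2) => y.
      (* The witness is the denominator minus 1, divided by x. *)
      apply: (@fps_unit1 _ (3 + x + y - x * y + y ^+ 2)).
      by rewrite -/x; ring.
  have -> : (r %/ 2 = r./2)%N by lia.
  rewrite expr0 mul1r.
  have r2_gt0 : (0 < r./2)%N by lia.
  have -> : (- x) ^+ r = (- x) ^+ r./2 ^+ 2.
    by rewrite -exprM; congr (_ ^+ _); lia.
  rewrite !exprD !expr1; apply: (fps_sum1_det_TH1 gd).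
  + rewrite exprD !scaleE /= !fps_scaleN1X -/x.
    by move: ((- x) ^+ r./2) => y; ring.
  + rewrite exprD !scaleE /= !fps_scaleN1X -/x.
    by move: ((- x) ^+ r./2) => y; ring.
  (* The half power occurs here without a further factor x, so one factor is split off before the
     rest is abstracted as y. *)
  + rewrite -(prednK r2_gt0) [(- x) ^+ (r./2).-1.+1]exprS.
    move: ((- x) ^+ (r./2).-1) => y.
    apply: (@fps_unit1 _ (3 + x + 2 * y + 3 * x * y + x * y ^+ 2)).
    by rewrite -/x; ring.
- move: gd r_half; case: (odd r) => gd r_half.
    have [-> ->] : [/\ (r + 1) %/ 2 = r./2 + 1 & (r + 3) %/ 2 = r./2 + 2]%N.
      by split; lia.
    have -> : x ^+ r = x * x ^+ r./2 ^+ 2.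
      by rewrite -exprM -exprS; congr (_ ^+ _); lia.
    apply: (fps_sum1_det_THN1 gd).
      by rewrite -/x !exprD !expr1; move: (x ^+ r./2) => y; ring.
    rewrite -/x !exprD !expr1; move: (x ^+ r./2) => y.
    apply: (@fps_unit1 _ (- 3 + x - 3 * y + x * y - y ^+ 2)).
    by rewrite -/x; ring.
  have -> : (r %/ 2 = r./2)%N by lia.
  have r2_gt0 : (0 < r./2)%N by lia.
  have -> : x ^+ r = x ^+ r./2 ^+ 2.
    by rewrite -exprM; congr (_ ^+ _); lia.
  apply: (fps_sum1_det_THN1 gd).
    by rewrite -/x !exprD !expr1; move: (x ^+ r./2) => y; ring.
  rewrite !exprD !expr1 -(prednK r2_gt0) [x ^+ (r./2).-1.+1]exprS.
  move: (x ^+ (r./2).-1) => y.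
  apply: (@fps_unit1 _ (- 3 + x - 2 * y + x * y + x * y ^+ 2)).
  by rewrite -/x; ring.
have r1E : (r - 1 = r - 2 + 1)%N by lia.
have xr (z : fps int) : z ^+ r = z ^+ (r - 2) * z ^+ 2.
  by rewrite -exprD subnK // ltnW.
apply: (fps_sum1_det_TH1 (trib_shift_gf hr)).
- rewrite !scaleE /= !fps_scaleN1X -/x r1E xr exprD.
  by move: ((- x) ^+ (r - 2)) => y; ring.
- rewrite !scaleE /= !fps_scaleN1X -/x r1E xr exprD.
  by move: ((- x) ^+ (r - 2)) => y; ring.
(* As r is at least 3, the power r - 2 contains a factor - x, which shows that the constant
   coefficient of the denominator is 1. *)
- have r2E : (r - 2 = (r - 3).+1)%N by lia.
  rewrite r1E xr exprD r2E [(- x) ^+ (r - 3).+1]exprS.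
  move: ((- x) ^+ (r - 3)) => y.
  apply: (@fps_unit1 _ (- 2 + x - y + x * y - x ^+ 2 * y)).
  by rewrite -/x; ring.
Qed.
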